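(* For every integer $k\ge 1$, define the formal power series $$\tilde C_k(q)=(-1)^k\Biggl(1-\frac{1}{(q;q)_\infty}\sum_{r=1-k}^{k}(-1)^r q^{r(3r-1)/2}\Biggr)\prod_{r\ge 1}\bigl(q^{2^r r};q^{2^{r+1}r}\bigr)_\infty.$$ Then $\tilde C_k(q)$ has nonnegative coefficients for all $k\ge 1$. Furthermore, writing $\tilde C_k(q)=\sum_{n\ge 0}\tilde c_k(n)q^n$, we have $\tilde c_k(n)>0$ if and only if $n\ge g_k$, where $g_k=\frac{k(3k+1)}{2}$.
   Context: All series are formal power series in $q$ with integer coefficients. $(a;q)_\infty:=\prod_{i\ge 0}(1-aq^i)$; thus $(q;q)_\infty=\prod_{m\ge 1}(1-q^m)$ and $\bigl(q^{2^r r};q^{2^{r+1}r}\bigr)_\infty=\prod_{i\ge 0}\bigl(1-q^{2^r r(2i+1)}\bigr)$. For $k\ge 1$, $g_k:=\frac{k(3k+1)}{2}$. *)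

(* Defs.v *)
From HB Require Import structures.
From mathcomp Require Import all_boot all_order all_algebra.
From mathcomp Require Import boolp classical_sets filter.

Set Implicit Arguments.
Unset Strict Implicit.
Unset Printing Implicit Defensive.

Import Order.TTheory GRing.Theory Num.Theory.

Local Open Scope classical_set_scope.
Local Open Scope ring_scope.

(* The ring Z[[q]]; [f n] is the coefficient of q^n in [f]. *)
Record fps := Fps { coef_fps :> nat -> int }.

Lemma fpsP (f g : fps) : (forall n, f n = g n) -> f = g.
Proof. by case: f g => [f] [g] /= /funext ->. Qed.

HB.instance Definition _ := gen_eqMixin fps.
HB.instance Definition _ := gen_choiceMixin fps.

Definition fps_zero := Fps (fun=> 0).
Definition fps_one := Fps (fun n => (n == 0%N)%:R).
Definition fps_opp (f : fps) := Fps (fun n => - f n).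
Definition fps_add (f g : fps) := Fps (fun n => f n + g n).
Definition fps_mul (f g : fps) :=
  Fps (fun n => \sum_(j < n.+1) f j * g (n - j)%N).

Fact fps_addA : associative fps_add.
Proof. by move=> f g h; apply: fpsP => n /=; rewrite addrA. Qed.
Fact fps_addC : commutative fps_add.
Proof. by move=> f g; apply: fpsP => n /=; rewrite addrC. Qed.
Fact fps_add0 : left_id fps_zero fps_add.
Proof. by move=> f; apply: fpsP => n /=; rewrite add0r. Qed.
Fact fps_addN : left_inverse fps_zero fps_opp fps_add.
Proof. by move=> f; apply: fpsP => n /=; rewrite addNr. Qed.

HB.instance Definition _ :=
  GRing.isZmodule.Build fps fps_addA fps_addC fps_add0 fps_addN.

Fact fps_mulC : commutative fps_mul.
Proof.
move=> f g; apply: fpsP => n /=; rewrite (reindex_inj rev_ord_inj) /=.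
by apply: eq_bigr => j _; rewrite subSS subKn ?leq_ord // mulrC.
Qed.

Fact fps_mulA : associative fps_mul.
Proof.
move=> f g h; rewrite (fps_mulC (fps_mul f g)); apply: fpsP => i /=.
pose coef3 j k := f j * (h k * g (i - j - k)%N).
transitivity (\sum_(j < i.+1) \sum_(k < i.+1 | (k <= i - j)%N) coef3 j k).
  apply: eq_bigr => /= j _; rewrite (_ : \sum_(_ < _) _ = fps_mul h g (i - j)%N).
    by rewrite /= big_distrr /= (big_ord_narrow_leq (leq_subr _ _)).
  by rewrite fps_mulC.
rewrite (exchange_big_dep predT) //=; apply: eq_bigr => k _.
transitivity (\sum_(j < i.+1 | (j <= i - k)%N) coef3 j k).
  apply: eq_bigl => j; rewrite -ltnS -(ltnS j) -!subSn ?leq_ord //.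
  by rewrite -subn_gt0 -(subn_gt0 j) -!subnDA addnC.
rewrite (big_ord_narrow_leq (leq_subr _ _)) big_distrr /=.
by apply: eq_bigr => j _; rewrite /coef3 -!subnDA addnC mulrCA.
Qed.

Fact fps_mul1 : left_id fps_one fps_mul.
Proof.
move=> f; apply: fpsP => n /=; rewrite big_ord_recl /= subn0 mul1r.
by rewrite big1 ?addr0 // => j _; rewrite mul0r.
Qed.

Fact fps_mulDl : left_distributive fps_mul +%R.
Proof.
move=> f g h; apply: fpsP => n /=; rewrite -big_split.
by apply: eq_bigr => j _; rewrite mulrDl.
Qed.

Fact fps_one_neq0 : fps_one != 0.
Proof. by apply/eqP => /(congr1 (fun f : fps => f 0%N)). Qed.

HB.instance Definition _ := GRing.Zmodule_isComNzRing.Build fps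
  fps_mulA fps_mulC fps_mul1 fps_mulDl fps_one_neq0.

Definition fps_unit : {pred fps} := fun f : fps => f 0%N \is a GRing.unit.

(* First [n] coefficients of 1 / f, from \sum_(i <= m) f (m - i) h_i = [m = 0]. *)
Fixpoint fps_inv_seq (f : fps) (n : nat) : seq int :=
  if n is m.+1 then
    let s := fps_inv_seq f m in
    rcons s ((f 0%N)^-1 * ((m == 0%N)%:R - \sum_(i < m) f (m - i)%N * s`_i))
  else [::].

Definition fps_inv (f : fps) : fps :=
  if fps_unit f then Fps (fun n => (fps_inv_seq f n.+1)`_n) else f.

Lemma size_fps_inv_seq f n : size (fps_inv_seq f n) = n.
Proof. by elim: n => //= n IHn; rewrite size_rcons IHn. Qed.

Lemma nth_fps_inv_seq f n i :
  (i < n)%N -> (fps_inv_seq f n)`_i = (fps_inv_seq f i.+1)`_i.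
Proof.
elim: n => // n IHn; rewrite ltnS leq_eqVlt => /predU1P[-> //|lt_in].
by rewrite -(IHn lt_in) /= nth_rcons size_fps_inv_seq lt_in.
Qed.

Fact fps_mulVf : {in fps_unit, left_inverse 1 fps_inv *%R}.
Proof.
move=> f Uf; rewrite mulrC; apply: fpsP => n.
rewrite /fps_inv -[fps_unit f]/(f \in fps_unit) Uf.
rewrite -[LHS]/(\sum_(j < n.+1) f j * (fps_inv_seq f (n - j).+1)`_(n - j)%N).
rewrite (reindex_inj rev_ord_inj) big_ord_recr.
have -> : val (rev_ord (@ord_max n)) = 0%N by rewrite /= subnn.
rewrite subn0 [fps_inv_seq]lock /= -lock {2}/fps_inv_seq -/fps_inv_seq.
rewrite nth_rcons size_fps_inv_seq ltnn eqxx mulrA mulrV // mul1r addrC.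
rewrite -[RHS]addr0 -addrA; congr (_ + _); apply/eqP.
rewrite addrC subr_eq0; apply/eqP/eq_bigr => i _.
by rewrite subSS subKn ?(ltnW (ltn_ord i)) // (nth_fps_inv_seq _ (ltn_ord i)).
Qed.

Fact fps_unitPl f g : g * f = 1 -> fps_unit f.
Proof.
move=> /(congr1 (fun h : fps => h 0%N)) /=; rewrite big_ord1 /= => gf1.
by apply/unitrPr; exists (g 0%N); rewrite mulrC.
Qed.

Fact fps_inv_out : {in [predC fps_unit], fps_inv =1 id}.
Proof. by move=> f /negPf nUf; rewrite /fps_inv -[fps_unit f]/(f \in fps_unit) nUf. Qed.

HB.instance Definition _ :=
  GRing.ComNzRing_hasMulInverse.Build fps fps_mulVf fps_unitPl fps_inv_out.

Definition qX : fps := Fps (fun n => (n == 1%N)%:R).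

(* Limit in the q-adic topology: each coefficient is eventually constant
   (with value 0 in the coefficients for which this fails). *)
Definition fps_lim (u : nat -> fps) : fps :=
  Fps (fun n => xget 0 [set c : int | \forall m \near \oo, u m n = c]).

Lemma fps_limE (u : nat -> fps) (f : fps) :
  (forall n, \forall m \near \oo, u m n = f n) -> fps_lim u = f.
Proof.
move=> uf; apply: fpsP => n /=; apply: xget_unique; first exact: uf.
move=> c [N _ uc]; have [M _ uM] := uf n.
rewrite -(uc (maxn N M)) /= ?leq_maxl //.
by apply: uM; rewrite /= leq_maxr.
Qed.

Definition fps_iprod (F : nat -> fps) : fps :=
  fps_lim (fun m => \prod_(i < m) F i).

Lemma fps_iprodE (F : nat -> fps) (n m : nat) :
  (forall i j, (j <= i)%N -> F i j = (j == 0%N)%:R) -> (n <= m)%N ->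
  fps_iprod F n = (\prod_(i < m) F i) n.
Proof.
move=> F1 le_nm.
have step p k : (n <= p)%N -> (\prod_(i < p + k) F i) n = (\prod_(i < p) F i) n.
  move=> le_np; elim: k => [|k IHk]; first by rewrite addn0.
  rewrite addnS (_ : \prod_(i < (p + k).+1) F i = F (p + k)%N * \prod_(i < p + k) F i);
    last by rewrite big_ord_recr mulrC.
  rewrite -IHk -[LHS]/(\sum_(j < n.+1)
    F (p + k)%N j * (\prod_(i < p + k) F i) (n - j)%N).
  rewrite big_ord_recl subn0 (F1 _ 0%N) // mul1r [X in _ + X]big1 ?addr0 //= => j _.
  have le_j : (bump 0 j <= p + k)%N.
    by rewrite (leq_trans (ltn_ord j)) // (leq_trans le_np) ?leq_addr.
  by rewrite (F1 _ (bump 0 j)) // mul0r.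
have stable p : (n <= p)%N -> (\prod_(i < p) F i) n = (\prod_(i < n) F i) n.
  by move=> le_np; rewrite -(subnKC le_np) step.
rewrite (stable m) //=; apply: xget_unique; first by exists n => // p /= /stable.
move=> c [N _ uc]; rewrite -(uc (maxn N n)) ?stable ?leq_maxr //=.
by rewrite leq_maxl.
Qed.

(* (a; b)_oo *)
Definition qpoch (a b : fps) : fps := fps_iprod (fun i => 1 - a * b ^+ i).

Definition pent (r : int) : nat := `|(r * (3 * r - 1) %/ 2)%Z|%N.

Definition gk (k : nat) : nat := ((k * (3 * k + 1)) %/ 2)%N.

(* In the sum r = j + 1 - k runs over the integers from 1 - k to k; in the
   product the index i stands for r = i + 1. *)
Definition Ctilde (k : nat) : fps :=
  (-1) ^+ k
  * (1 - 1 / qpoch qX qX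
         * \sum_(j < 2 * k)
             (let r : int := j%:Z + 1 - k%:Z in (-1) ^ r * qX ^+ pent r))
  * fps_iprod (fun i =>
      let r := i.+1 in
      qpoch (qX ^+ (2 ^ r * r)%N) (qX ^+ (2 ^ r.+1 * r)%N)).

(* Main.v *)
(** Write [g_j = j (3 j + 1) / 2]. By a finite form of Euler's pentagonal number
theorem, [(q;q)_oo] minus the truncated sum is [(-1)^k q^(g_k) T_k], where
[T_k = 1 - q^(2k+1) - q^(3k+2) T_(k+1)]. On the other side, with
[E_d = prod_(i >= 1) (1 + q^(d i)) = 1 / (q^d; q^(2d))_oo] one has
[1 / (q;q)_oo = prod_(r >= 0) E_(2^r)], and the given product is
[prod_(r >= 1) 1 / E_(2^r r)]. Each quotient [E_(2^r) / E_(2^r r)] is the product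
of the [1 + q^(2^r i)] over the [i] not divisible by [r], so the theorem reduces
to the positivity of the coefficients of [T_k E_1 = T_k / (q;q^2)_oo]. The four
factors [1 - q, 1 - q^3, 1 - q^5, 1 - q^7] of the denominator already suffice:
the number of partitions of [n] into parts 1, 3, 5 is
[(n (n + 9) + periodic) / 30], and the recurrence for [T_k] propagates upper and
lower bounds that are linear in [n] and quadratic in [k]; they give positivity
except for finitely many pairs [(k, n)], which are computed. The factor
[1 - q^7] is needed because [T_1 / ((1 - q) (1 - q^3) (1 - q^5))] has six
vanishing coefficients. *)

From Stdlib Require Import ZArith Lia List.

(** * Integer estimates for the coefficients of 30 T_k / ((1 - q) (1 - q^3) (1 - q^5)) *)

Module TailBounds.
Import ListNotations.
Local Open Scope Z_scope.

(** The periodic part of the quasi-polynomial [c135]. The default 8 lies outside the residues modulo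
    15 and keeps [res135_bounds] true for every argument. *)
Definition res135 (r : Z) : Z :=
  nth (Z.to_nat r) [30; 20; 8; 24; 8; 20; 30; 8; 14; 18; 20; 20; 18; 14; 8] 8.

(* Thirty times the number of partitions of [n] into parts 1, 3 and 5. *)
Definition c135 (n : Z) : Z :=
  if n <? 0 then 0 else n * (n + 9) + res135 (n mod 15).

(* The [n]-th coefficient of [30 T_k / ((1 - q) (1 - q^3) (1 - q^5))], as soon as
   the fuel [f] exceeds [n]. *)
Fixpoint tailc (f : nat) (k n : Z) : Z :=
  match f with
  | S f' =>
    if n <? 0 then 0 else
    c135 n - c135 (n - (2 * k + 1)) - tailc f' (k + 1) (n - (3 * k + 2))
  | O => 0
  end.

Lemma res135_bounds r : 8 <= res135 r <= 30.
Proof.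
unfold res135; generalize (Z.to_nat r) as i.
do 15 (intros [|i]; [simpl; lia|revert i; cbn [nth]]).
intros [|i]; simpl; lia.
Qed.

Lemma c135_neg n : n < 0 -> c135 n = 0.
Proof. intros Hn; unfold c135; destruct (Z.ltb_spec n 0); lia. Qed.

Lemma c135_bounds n :
  0 <= n -> n * (n + 9) + 8 <= c135 n <= n * (n + 9) + 30.
Proof.
intros Hn; unfold c135; pose proof (res135_bounds (n mod 15)).
destruct (Z.ltb_spec n 0); lia.
Qed.

(** Multiplying out (1 - q) (1 - q^3) (1 - q^5) certifies the closed formula without counting
    partitions. Once the residue modulo 15 is fixed and no argument is negative, this is a
    polynomial identity in [n]. *)
Lemma c135_rec n :
  (c135 n - c135 (n - 1)) - (c135 (n - 3) - c135 (n - 3 - 1))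
  - ((c135 (n - 5) - c135 (n - 5 - 1)) - (c135 (n - 5 - 3) - c135 (n - 5 - 3 - 1)))
  = if n =? 0 then 30 else 0.
Proof.
destruct (Z.ltb_spec n 0) as [Hn|Hn].
  now rewrite !c135_neg by lia; destruct (Z.eqb_spec n 0); lia.
(* The largest shift is 9 = 1 + 3 + 5; below it some argument is negative. *)
destruct (Z.ltb_spec n 9) as [Hn9|Hn9].
  assert (H : n = 0 \/ n = 1 \/ n = 2 \/ n = 3 \/ n = 4 \/ n = 5 \/ n = 6 \/ n = 7
    \/ n = 8) by lia.
  now repeat destruct H as [->|H]; [..|rewrite H].
destruct (Z.eqb_spec n 0) as [|_]; [lia|].
unfold c135; rewrite !(proj2 (Z.ltb_ge _ 0)) by lia.
rewrite <- !Z.sub_add_distr; cbn [Z.add Pos.add Pos.succ].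
assert (Hr := Z.mod_pos_bound n 15 ltac:(lia)).
rewrite <- !(Zminus_mod_idemp_l n).
remember (n mod 15) as r eqn:Er; clear Er.
assert (H : r = 0 \/ r = 1 \/ r = 2 \/ r = 3 \/ r = 4 \/ r = 5 \/ r = 6 \/ r = 7
  \/ r = 8 \/ r = 9 \/ r = 10 \/ r = 11 \/ r = 12 \/ r = 13 \/ r = 14) by lia.
repeat destruct H as [->|H]; [..|rewrite H]; clear;
repeat match goal with |- context [res135 ?a] =>
  let b := eval vm_compute in (res135 a) in change (res135 a) with b end; lia.
Qed.

Lemma tailc_neg f k n : n < 0 -> tailc f k n = 0.
Proof. intros Hn; destruct f; cbn [tailc]; destruct (Z.ltb_spec n 0); lia. Qed.

Lemma tailcS f k n : 0 <= n -> tailc (S f) k n =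
  c135 n - c135 (n - (2 * k + 1)) - tailc f (k + 1) (n - (3 * k + 2)).
Proof. intros Hn; cbn [tailc]; destruct (Z.ltb_spec n 0); lia. Qed.

Lemma tailc_small f k n : 0 <= n < 3 * k + 2 ->
  tailc (S f) k n = c135 n - c135 (n - (2 * k + 1)).
Proof.
intros Hn; cbn [tailc]; destruct (Z.ltb_spec n 0); [lia|].
rewrite (tailc_neg f) by lia; lia.
Qed.

(* Replacing [c135 n] by [n (n + 9)] turns the recurrence for [6 * tailc] into one
   solved by [6 k (2 n + k + 11)], up to an error of at most 6 * 22 per step. The
   deviation allowed here, [10 n + 15 k^2 - 127 k + 1510], grows along the
   recurrence by exactly that much, and its free constant 1510 covers the initial
   range [n < 3 k + 2]. *)
Lemma tailc_bounds f k n : 1 <= k -> 0 <= n < Z.of_nat f ->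
  (12 * k - 10) * n - 9 * k * k + 193 * k - 1510 <= 6 * tailc f k n
  <= (12 * k + 10) * n + 21 * k * k - 61 * k + 1510.
Proof.
revert k n; induction f as [|f IHf]; intros k n Hk Hn; [lia|].
pose proof (c135_bounds n ltac:(lia)) as Cn.
destruct (Z.ltb_spec n (3 * k + 2)) as [Hnk|Hnk].
  rewrite tailc_small by lia.
  destruct (Z.ltb_spec n (2 * k + 1)) as [Hnk2|Hnk2].
    rewrite (c135_neg (n - _)) by lia.
    (* Certificates for [lia], which treats monomials as atoms: the first two squares give the lower
       bound, the product and the last square the upper one. *)
    pose proof (Z.square_nonneg (3 * n - 3 * k + 16)).
    pose proof (Z.square_nonneg (2 * k - 43)).
    assert (0 <= n * (2 * k - n)) by (apply Z.mul_nonneg_nonneg; lia).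
    pose proof (Z.square_nonneg (7 * k - 25)).
    split; lia.
  pose proof (c135_bounds (n - (2 * k + 1)) ltac:(lia)).
  assert (0 <= (n - (2 * k + 1)) * (12 * k + 22)) by (apply Z.mul_nonneg_nonneg; lia).
  assert (0 <= (3 * k + 1 - n) * (12 * k + 2)) by (apply Z.mul_nonneg_nonneg; lia).
  pose proof (Z.square_nonneg (k - 10)).
  pose proof (Z.square_nonneg (k - 3)).
  split; lia.
assert (IH := IHf (k + 1) (n - (3 * k + 2)) ltac:(lia) ltac:(lia)).
pose proof (c135_bounds (n - (2 * k + 1)) ltac:(lia)) as Cnk.
cbn [tailc]; destruct (Z.ltb_spec n 0); [lia|].
split; lia.
Qed.

Lemma tailc_fuel f f' k n : 0 <= k -> n < Z.of_nat f -> n < Z.of_nat f' ->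
  tailc f k n = tailc f' k n.
Proof.
revert f' k n; induction f as [|f IHf]; intros f' k n Hk Hf Hf'.
  now rewrite !tailc_neg by lia.
destruct f' as [|f']; [now rewrite !tailc_neg by lia|].
cbn [tailc]; destruct (Z.ltb_spec n 0); [lia|].
now rewrite (IHf f') by lia.
Qed.

(** Below 3k + 2 the recursion stops at once. Beyond, the lower bound of [tailc_bounds] increases in
    [n]: at n = 3k + 2 it is 27k^2 + 187k - 1530, positive from k = 5 on; for k = 1 it is 2n - 1326,
    whence 664; and 84 suffices for k = 2, 3, 4. *)
Lemma tailc_pos f k n : 1 <= k -> 0 <= n < Z.of_nat f ->
  5 <= k \/ 2 <= k /\ 84 <= n \/ 664 <= n -> 0 < tailc f k n.
Proof.
intros Hk Hn Hkn; pose proof (c135_bounds n ltac:(lia)) as Cn.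
destruct (Z.ltb_spec n (3 * k + 2)) as [Hnk|Hnk].
  destruct f as [|f]; [lia|]; rewrite tailc_small by lia.
  destruct (Z.ltb_spec n (2 * k + 1)) as [Hnk2|Hnk2].
    rewrite (c135_neg (n - _)) by lia; nia.
  pose proof (c135_bounds (n - (2 * k + 1)) ltac:(lia)).
  assert (0 <= (n - (2 * k + 1)) * k) by (apply Z.mul_nonneg_nonneg; lia).
  assert (1 <= k * k) by nia; lia.
pose proof (tailc_bounds f k n Hk Hn).
assert (0 <= (n - (3 * k + 2)) * (12 * k - 10)) by (apply Z.mul_nonneg_nonneg; lia).
destruct Hkn as [Hk5|Hn7].
  assert (0 <= (k - 5) * k) by (apply Z.mul_nonneg_nonneg; lia); lia.
destruct (Z_lt_le_dec k 5).
2: assert (0 <= (k - 5) * k) by (apply Z.mul_nonneg_nonneg; lia); lia.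
assert (H4 : k = 1 \/ k = 2 \/ k = 3 \/ k = 4) by lia.
repeat destruct H4 as [->|H4]; [..|subst k]; lia.
Qed.

(** The pairs that [tailc_pos] leaves open. Its thresholds 664 and 84 grow by 7 because n - 7 has to
    lie beyond them as well. *)
Lemma tailc_check :
  forallb (fun kb : nat * nat => forallb (fun n : nat =>
    let t m := tailc 671 (Z.of_nat (fst kb)) m in
    (0 <=? t (Z.of_nat n)) && (0 <? t (Z.of_nat n) + t (Z.of_nat n - 7)))%bool
    (seq 0 (snd kb))) [(1, 671); (2, 91); (3, 91); (4, 91)]%nat = true.
Proof. now vm_compute. Qed.

(** A vanishing coefficient is compensated by the one seven places earlier, which division by 1 -
    q^7 adds to it. *)
Lemma tailc_ge0_gt0 f k n : 1 <= k -> 0 <= n < Z.of_nat f ->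
  0 <= tailc f k n /\ 0 < tailc f k n + tailc f k (n - 7).
Proof.
intros Hk Hn.
assert (Hkn : (5 <= k \/ 2 <= k /\ 91 <= n \/ 671 <= n) \/
  exists b, In (Z.to_nat k, b) [(1, 671); (2, 91); (3, 91); (4, 91)]%nat
    /\ n < Z.of_nat b).
  destruct (Z_lt_le_dec k 5); [|lia].
  assert (H4 : k = 1 \/ k = 2 \/ k = 3 \/ k = 4) by lia.
  destruct H4 as [->|H4].
    destruct (Z_lt_le_dec n 671); [|lia].
    right; exists 671%nat; split; [now left|lia].
  destruct (Z_lt_le_dec n 91); [|lia].
  right; exists 91%nat; split; [|lia].
  now destruct H4 as [->|[->| ->]]; simpl; tauto.
destruct Hkn as [Hkn|[b [Hb Hnb]]].
  pose proof (tailc_pos f k n Hk Hn ltac:(lia)).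
  destruct (Z_lt_le_dec n 7); [rewrite (tailc_neg f k (n - 7)) by lia; lia|].
  pose proof (tailc_pos f k (n - 7) Hk ltac:(lia) ltac:(lia)); lia.
assert (H := tailc_check); rewrite forallb_forall in H.
specialize (H _ Hb); rewrite forallb_forall in H.
specialize (H (Z.to_nat n) ltac:(apply in_seq; simpl; lia)); simpl fst in H.
rewrite !Z2Nat.id in H by lia.
assert (n < 671) by (destruct Hb as [E|[E|[E|[E|[]]]]]; injection E as _ <-; lia).
rewrite !(tailc_fuel f 671) by lia.
destruct (andb_prop _ _ H); lia.
Qed.

End TailBounds.

Require Import Defs.
From mathcomp Require Import all_boot all_order all_algebra.
From mathcomp Require Import ring zify ssrZ.

Set Implicit Arguments.
Unset Strict Implicit.
Unset Printing Implicit Defensive.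

Import Order.TTheory GRing.Theory Num.Theory.
Import TailBounds.

Local Open Scope ring_scope.
Local Delimit Scope Z_scope with coqZ.

(** * The pentagonal number theorem, in finite form *)

(** The truncated pentagonal sum with the indices r = -j and r = j + 1 paired. *)
Definition ptrunc (R : comNzRingType) (q : R) (n : nat) : R :=
  \sum_(j < n) (-1) ^+ j * q ^+ gk j * (1 - q ^+ (2 * j + 1)).

Lemma gkE n : gk n = (n * n + 'C(n.+1, 2))%N.
Proof.
rewrite /gk bin2 -divn2 /=.
have -> : (n * (3 * n + 1) = n * n * 2 + n.+1 * n)%N by ring.
by rewrite divnMDl.
Qed.

Lemma gkS n : gk n.+1 = (gk n + 3 * n + 2)%N.
Proof. by rewrite !gkE (binS n.+1) bin1; ring. Qed.

(* Shanks's identity; modulo q^(n+1) only the term s = 0 survives on the left. *)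
Lemma shanks (R : comNzRingType) (q : R) n :
  \sum_(s < n.+1) (-1) ^+ s * \prod_(s <= i < n) (1 - q ^+ i.+1)
    * q ^+ (s * n + 'C(s.+1, 2))
  = ptrunc q n + (-1) ^+ n * q ^+ gk n.
Proof.
pose qfac s m : R := \prod_(s <= i < m) (1 - q ^+ i.+1).
pose term m s : R := (-1) ^+ s * qfac s m * q ^+ (s * m + 'C(s.+1, 2)).
rewrite -[LHS]/(\sum_(s < n.+1) term n s).
elim: n => [|n IHn].
  by rewrite big_ord1 /ptrunc big_ord0 /term /qfac big_geq //= gkE !mul1r add0r.
have qfac_r s : (s <= n)%N -> qfac s n.+1 = (1 - q ^+ n.+1) * qfac s n.
  by move=> le_sn; rewrite /qfac big_nat_recr // mulrC.
have qfac_l s : (s < n)%N -> qfac s n = (1 - q ^+ s.+1) * qfac s.+1 n.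
  by move=> lt_sn; rewrite /qfac big_ltn.
(* Expanding the new factor 1 - q^(n+1) splits each term at n + 1 into [low s - high s]. Since
   [low s.+1] exceeds [term n s.+1] by [high s], the sum telescopes to the one at [n] plus two
   boundary terms. *)
pose low s := (-1) ^+ s * qfac s n * q ^+ (s * n + s + 'C(s.+1, 2)).
pose high s := (-1) ^+ s * qfac s n * q ^+ (s.+1 * n.+1 + 'C(s.+1, 2)).
have termS s : (s <= n)%N -> term n.+1 s = low s - high s.
  move=> le_sn; rewrite /term qfac_r // /low /high.
  have -> : (s * n + s = s * n.+1)%N by ring.
  have -> : (s.+1 * n.+1 + 'C(s.+1, 2) = n.+1 + (s * n.+1 + 'C(s.+1, 2)))%N by ring.
  by rewrite [q ^+ (n.+1 + _)]exprD; ring.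
have low_term s : (s < n)%N -> term n s.+1 - low s.+1 = - high s.
  move=> lt_sn; rewrite /term /low /high (qfac_l _ lt_sn) exprS.
  rewrite (binS s.+1) bin1.
  have -> : (s.+1 * n + ('C(s.+1, 2) + s.+1) = s.+1 * n.+1 + 'C(s.+1, 2))%N by ring.
  have -> : (s.+1 * n + s.+1 + ('C(s.+1, 2) + s.+1)
            = s.+1 + (s.+1 * n.+1 + 'C(s.+1, 2)))%N by ring.
  by rewrite [in X in _ - X]exprD; ring.
have low0 : low 0%N = term n 0%N by rewrite /low /term mul0n.
rewrite big_ord_recr /=.
rewrite (eq_bigr (fun s : 'I_n.+1 => low s - high s)) => [|s _]; last first.
  by rewrite termS // -ltnS.
rewrite sumrB.
have lowE : \sum_(s < n.+1) low s = \sum_(s < n.+1) term n s + \sum_(s < n) high s.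
  rewrite !(big_ord_recl n) low0 -addrA; congr (_ + _).
  rewrite -big_split; apply: eq_bigr => s _.
  by rewrite /= -[high s]opprK -low_term //; ring.
rewrite lowE IHn [\sum_(s < n.+1) high s]big_ord_recr /=.
rewrite /ptrunc big_ord_recr /= /high /term /qfac !big_geq // gkS.
have -> : (n.+1 * n.+1 + 'C(n.+1, 2) = gk n + (2 * n + 1))%N by rewrite gkE; ring.
have -> : (n.+1 * n.+1 + 'C(n.+2, 2) = gk n + 3 * n + 2)%N.
  by rewrite gkE (binS n.+1) bin1; ring.
by rewrite [q ^+ (gk n + (2 * n + 1))]exprD; ring.
Qed.
(* The series [T_k], cut off after [f] steps of its recurrence. *)
Fixpoint ptail (R : comNzRingType) (q : R) (f k : nat) : R :=
  if f is f'.+1 then 1 - q ^+ (2 * k + 1) - q ^+ (3 * k + 2) * ptail q f' k.+1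
  else 0.

Lemma ptruncD (R : comNzRingType) (q : R) f k :
  ptrunc q (k + f) - ptrunc q k = (-1) ^+ k * q ^+ gk k * ptail q f k.
Proof.
elim: f k => [|f IHf] k; first by rewrite addn0 subrr mulr0.
have -> : ptrunc q (k + f.+1) - ptrunc q k =
    (ptrunc q (k.+1 + f) - ptrunc q k.+1) + (ptrunc q k.+1 - ptrunc q k).
  by rewrite addnS -addSn; ring.
rewrite IHf [ptrunc q k.+1]big_ord_recr /= gkS !exprD exprS.
by rewrite /ptrunc; ring.
Qed.

Lemma gk_mul2 k : (gk k * 2 = k * (3 * k + 1))%N.
Proof. by elim: k => // k IHk; rewrite gkS !mulnDl IHk; ring. Qed.

Lemma leq_gk n : (n <= gk n)%N.
Proof. by elim: n => // n; rewrite gkS; lia. Qed.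

Lemma pent_posS k : pent k.+1 = (gk k + (2 * k + 1))%N.
Proof.
rewrite /pent.
have -> : k.+1%:Z * (3 * k.+1%:Z - 1) = ((gk k + (2 * k + 1)) * 2)%N.
  by rewrite mulnDl gk_mul2; lia.
by rewrite PoszM mulzK.
Qed.

Lemma pent_neg k : pent (- k%:Z) = gk k.
Proof.
rewrite /pent.
have -> : - k%:Z * (3 * (- k%:Z) - 1) = (gk k * 2)%N by rewrite gk_mul2; lia.
by rewrite PoszM mulzK.
Qed.

Lemma ptrunc_pent k :
  \sum_(j < 2 * k) (let r : int := j%:Z + 1 - k%:Z in (-1) ^ r * qX ^+ pent r)
  = ptrunc qX k.
Proof.
elim: k => [|k IHk]; first by rewrite muln0 /ptrunc !big_ord0.
rewrite (_ : 2 * k.+1 = (2 * k).+2)%N; last by rewrite mulnS.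
(* The range of r grows by one index at each end: -k and k + 1. *)
rewrite big_ord_recl big_ord_recr /= [ptrunc _ _]big_ord_recr /= -/(ptrunc _ _) -IHk.
have -> : 0%:Z + 1 - k.+1%:Z = - k%:Z by lia.
have -> : (bump 0 (2 * k))%:Z + 1 - k.+1%:Z = k.+1%:Z by rewrite /bump /=; lia.
rewrite pent_neg pent_posS -invr_expz -exprnP invr_sign -exprnP.
rewrite (eq_bigr (fun j : 'I_(2 * k) => let r : int := j%:Z + 1 - k%:Z in
   (-1) ^ r * qX ^+ pent r)) => [|j _]; last first.
  by rewrite /bump /=; congr (_ ^ _ * _ ^+ pent _); lia.
by rewrite exprS exprD; ring.
Qed.

(** * Coefficientwise estimates in Z[[q]] *)

Lemma coef_fpsM (f g : fps) n : (f * g) n = \sum_(j < n.+1) f j * g (n - j)%N.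
Proof. by []. Qed.

Lemma coef_fpsXM (f : fps) n : (qX * f) n = if n is n'.+1 then f n' else 0.
Proof.
rewrite coef_fpsM big_ord_recl /= mul0r add0r.
case: n => [|n]; first by rewrite big_ord0.
rewrite big_ord_recl /= mul1r subn1 big1 ?addr0 // => i _.
by rewrite mul0r.
Qed.

Lemma coef_fpsXnM a (f : fps) n :
  (qX ^+ a * f) n = if (a <= n)%N then f (n - a)%N else 0.
Proof.
elim: a n => [|a IHa] n; first by rewrite mul1r subn0.
by rewrite exprS -mulrA coef_fpsXM; case: n => [|n] //; rewrite IHa subSS.
Qed.

Lemma coef_fpsXn a n : (qX ^+ a) n = (n == a)%:R.
Proof.
rewrite -[qX ^+ a]mulr1 coef_fpsXnM eqn_leq /= subn_eq0 andbC.
by case: (a <= n)%N.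
Qed.

Lemma coef0_fpsM (f g : fps) : (f * g) 0%N = f 0%N * g 0%N.
Proof. by rewrite coef_fpsM big_ord1. Qed.

Lemma fps_unit1 (f : fps) : f 0%N = 1 -> f \is a GRing.unit.
Proof. by move=> f0; rewrite unfold_in /= /fps_unit f0 unitr1. Qed.

Definition eqmodq N (f g : fps) := forall n, (n <= N)%N -> f n = g n.

Lemma eqmodqM N f f' g g' :
  eqmodq N f f' -> eqmodq N g g' -> eqmodq N (f * g) (f' * g').
Proof.
move=> ff' gg' n le_nN; rewrite !coef_fpsM; apply: eq_bigr => j _.
by rewrite ff' ?gg' // (leq_trans _ le_nN) ?leq_subr // -ltnS.
Qed.

Lemma eqmodq_sym N f g : eqmodq N f g -> eqmodq N g f.
Proof. by move=> fg n /fg. Qed.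

Lemma eqmodq_trans N f g h : eqmodq N f g -> eqmodq N g h -> eqmodq N f h.
Proof. by move=> fg gh n len; rewrite fg ?gh. Qed.

Lemma eqmodq_refl N f : eqmodq N f f.
Proof. by []. Qed.
#[local] Hint Resolve eqmodq_refl : core.

(* f^-1 = f^-1 g g^-1 = f^-1 f g^-1 modulo q^(N+1). *)
Lemma eqmodqV N f g : f \is a GRing.unit -> g \is a GRing.unit ->
  eqmodq N f g -> eqmodq N f^-1 g^-1.
Proof.
move=> Uf Ug fg; apply: (@eqmodq_trans _ _ (f^-1 * (g * g^-1))).
  by rewrite mulrV // mulr1.
rewrite -[X in eqmodq _ _ X]mul1r -(mulVr Uf) -mulrA.
by apply: eqmodqM => //; apply/eqmodq_sym/eqmodqM.
Qed.

Lemma fps_eqmodq f g : (forall N, eqmodq N f g) -> f = g.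
Proof. by move=> fg; apply: fpsP => n; apply: (fg n). Qed.

(** Factor i is 1 + O(q^(i+1)), so the first N factors determine the product modulo q^(N+1). *)
Definition prod_ok (F : nat -> fps) :=
  forall i j, (j <= i)%N -> F i j = (j == 0%N)%:R.

Lemma eqmodq_iprod F N M : prod_ok F -> (N <= M)%N ->
  eqmodq N (fps_iprod F) (\prod_(i < M) F i).
Proof. by move=> Fok leNM n lenN; apply: fps_iprodE; last exact: leq_trans leNM. Qed.

Definition fps_ge0 (f : fps) := forall n, 0 <= f n.

Lemma fps_ge0M f g : fps_ge0 f -> fps_ge0 g -> fps_ge0 (f * g).
Proof.
by move=> f0 g0 n; rewrite coef_fpsM; apply: sumr_ge0 => i _; apply: mulr_ge0.
Qed.

Lemma fps_ge01 : fps_ge0 1.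
Proof. by move=> n; apply: ler0n. Qed.

Lemma fps_ge0_prod (I : Type) (r : seq I) (P : pred I) (F : I -> fps) :
  (forall i, P i -> fps_ge0 (F i)) -> fps_ge0 (\prod_(i <- r | P i) F i).
Proof. exact: (big_ind fps_ge0 fps_ge01 fps_ge0M). Qed.

Lemma fps_ge0_iprod F : prod_ok F -> (forall i, fps_ge0 (F i)) ->
  fps_ge0 (fps_iprod F).
Proof.
by move=> Fok F0 n; rewrite (fps_iprodE Fok (leqnn n)); apply: fps_ge0_prod.
Qed.

Lemma coef0_iprod F : prod_ok F -> fps_iprod F 0%N = 1.
Proof. by move=> Fok; rewrite (fps_iprodE Fok (leqnn 0)) big_ord0. Qed.

Lemma coef_1DcXn (c : fps) m n : (0 < m)%N -> (n < m)%N ->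
  (1 + c * qX ^+ m) n = (n == 0%N)%:R.
Proof.
move=> m_gt0 lt_nm; rewrite -[LHS]/((1 : fps) n + (c * qX ^+ m) n) mulrC coef_fpsXnM.
by rewrite leqNgt lt_nm /= addr0.
Qed.

Lemma coef_1DXn m n : (n < m)%N -> (1 + qX ^+ m) n = (n == 0%N)%:R.
Proof. by move=> lt_nm; rewrite -[qX ^+ m]mul1r coef_1DcXn // (leq_trans _ lt_nm). Qed.

Lemma coef_1BXn m n : (n < m)%N -> (1 - qX ^+ m) n = (n == 0%N)%:R.
Proof. by move=> lt_nm; rewrite -mulN1r coef_1DcXn // (leq_trans _ lt_nm). Qed.

Lemma fps_ge0_geom m : (0 < m)%N -> fps_ge0 (1 - qX ^+ m)^-1.
Proof.
move=> m_gt0; set u := _^-1.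
have uE : u = 1 + qX ^+ m * u.
  have U : (1 - qX ^+ m : fps) \is a GRing.unit by apply: fps_unit1; rewrite coef_1BXn.
  by rewrite -{1}(mulVr U) -/u; ring.
move=> n; elim/ltn_ind: n => n IHn; rewrite uE.
rewrite -[X in 0 <= X]/((1 : fps) n + (qX ^+ m * u) n) coef_fpsXnM addr_ge0 ?ler0n //.
by case: leqP => // le_mn; apply: IHn; rewrite -subn_gt0 subKn.
Qed.

(** * Products *)

(* In the notation of the header, [pp d] is [E_d], and [ppV r d] is
   [E_d / E_(d r)]. *)
Definition qp m d := qpoch (qX ^+ m) (qX ^+ d).
Definition pp d := fps_iprod (fun i => 1 + qX ^+ (d * i.+1)).
Definition ppV r d :=
  fps_iprod (fun i => if (r %| i.+1)%N then 1 else 1 + qX ^+ (d * i.+1)).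

Lemma qpE m d : qp m d = fps_iprod (fun i => 1 - qX ^+ (m + d * i)).
Proof.
by congr fps_iprod; apply: boolp.funext => i; rewrite -exprM -exprD.
Qed.

Lemma ltn_Dmul m d i j : (0 < m)%N -> (0 < d)%N -> (j <= i)%N -> (j < m + d * i)%N.
Proof.
move=> m0 d0 le_ji; rewrite (leq_ltn_trans le_ji) // -[ltnLHS]add0n -addSn leq_add //.
by rewrite leq_pmull.
Qed.

Lemma qp_ok m d : (0 < m)%N -> (0 < d)%N -> prod_ok (fun i => 1 - qX ^+ (m + d * i)).
Proof. by move=> m0 d0 i j le_ji; rewrite coef_1BXn // ltn_Dmul. Qed.

Lemma ltn_mulS d i j : (0 < d)%N -> (j <= i)%N -> (j < d * i.+1)%N.
Proof. by move=> d0 le_ji; rewrite (leq_trans _ (leq_pmull _ d0)) // ltnS. Qed.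

Lemma pp_ok d : (0 < d)%N -> prod_ok (fun i => 1 + qX ^+ (d * i.+1)).
Proof. by move=> d0 i j le_ji; rewrite coef_1DXn // ltn_mulS. Qed.

Lemma ppV_ok r d : (0 < d)%N ->
  prod_ok (fun i => if (r %| i.+1)%N then 1 else 1 + qX ^+ (d * i.+1)).
Proof. by move=> d0 i j le_ji; case: ifP => // _; rewrite coef_1DXn // ltn_mulS. Qed.

Lemma eqmodq_qp m d N M : (0 < m)%N -> (0 < d)%N -> (N <= M)%N ->
  eqmodq N (qp m d) (\prod_(i < M) (1 - qX ^+ (m + d * i))).
Proof. by move=> m0 d0; rewrite qpE; apply/eqmodq_iprod/qp_ok. Qed.

Lemma eqmodq_pp d N M : (0 < d)%N -> (N <= M)%N ->
  eqmodq N (pp d) (\prod_(i < M) (1 + qX ^+ (d * i.+1))).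
Proof. by move=> d0; apply/eqmodq_iprod/pp_ok. Qed.

Lemma eqmodq_ppV r d N M : (0 < d)%N -> (N <= M)%N ->
  eqmodq N (ppV r d)
    (\prod_(i < M) if (r %| i.+1)%N then 1 else 1 + qX ^+ (d * i.+1)).
Proof. by move=> d0; apply/eqmodq_iprod/ppV_ok. Qed.

Lemma qp0 m d : (0 < m)%N -> (0 < d)%N -> qp m d 0%N = 1.
Proof. by move=> m0 d0; rewrite qpE; apply/coef0_iprod/qp_ok. Qed.

Lemma qp_unit m d : (0 < m)%N -> (0 < d)%N -> qp m d \is a GRing.unit.
Proof. by move=> m0 d0; apply/fps_unit1/qp0. Qed.

Lemma qp_shift m d : (0 < m)%N -> (0 < d)%N ->
  qp m d = (1 - qX ^+ m) * qp (m + d) d.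
Proof.
move=> m0 d0; apply: fps_eqmodq => N; have md0 : (0 < m + d)%N by rewrite addn_gt0 m0.
apply: eqmodq_trans (eqmodq_qp m0 d0 (leqnSn N)) _.
rewrite big_ord_recl /= muln0 addn0; apply: eqmodqM => //.
apply: eqmodq_sym; apply: eqmodq_trans (eqmodq_qp md0 d0 (leqnn N)) _.
rewrite (eq_bigr (fun i : 'I_N => 1 - qX ^+ (m + d * i.+1))) // => i _.
by rewrite -addnA -mulnS.
Qed.

Lemma qp_split d : (0 < d)%N -> qp d d = qp d (2 * d) * qp (2 * d) (2 * d).
Proof.
move=> d0; apply: fps_eqmodq => N; have d20 : (0 < 2 * d)%N by rewrite muln_gt0.
have leN : (N <= N.*2)%N by rewrite -addnn leq_addr.
apply: eqmodq_trans (eqmodq_qp d0 d0 leN) _; apply: eqmodq_sym.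
apply: eqmodq_trans
  (eqmodqM (eqmodq_qp d0 d20 (leqnn N)) (eqmodq_qp d20 d20 (leqnn N))) _.
suff -> : \prod_(i < N.*2) (1 - qX ^+ (d + d * i)) =
    (\prod_(i < N) (1 - qX ^+ (d + 2 * d * i)))
     * (\prod_(i < N) (1 - qX ^+ (2 * d + 2 * d * i))) by [].
elim: N {leN} => [|N IHN]; first by rewrite !big_ord0 mulr1.
rewrite doubleS !big_ord_recr IHN /=.
have -> : (d + d * N.*2 = d + 2 * d * N)%N by rewrite -mul2n; ring.
have -> : (d + d * N.*2.+1 = 2 * d + 2 * d * N)%N by rewrite -mul2n; ring.
by ring.
Qed.

Lemma pp_qp d : (0 < d)%N -> pp d * qp d d = qp (2 * d) (2 * d).
Proof.
move=> d0; apply: fps_eqmodq => N; have d20 : (0 < 2 * d)%N by rewrite muln_gt0.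
apply: eqmodq_trans (eqmodqM (eqmodq_pp d0 (leqnn N)) (eqmodq_qp d0 d0 (leqnn N))) _.
apply: eqmodq_sym; apply: eqmodq_trans (eqmodq_qp d20 d20 (leqnn N)) _.
rewrite -big_split; under [X in eqmodq _ _ X]eq_bigr => i _.
  rewrite /= -mulnS [_ * (1 - _)]mulrC -subr_sqr expr1n -exprM mulnC mulnA mulnS.
  over.
by [].
Qed.

(** Euler's theorem on odd and distinct parts: cancel (q^(2d); q^(2d))_oo between [qp_split] and
    [pp_qp]. *)
Lemma qp_pp d : (0 < d)%N -> qp d (2 * d) * pp d = 1.
Proof.
move=> d0; have d20 : (0 < 2 * d)%N by rewrite muln_gt0.
apply: (mulIr (qp_unit d20 d20)).
by rewrite mul1r -{2}(pp_qp d0) (qp_split d0); ring.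
Qed.

Lemma pp_split r d : (0 < r)%N -> (0 < d)%N -> pp d = pp (d * r) * ppV r d.
Proof.
move=> r0 d0; apply: fps_eqmodq => N; have dr0 : (0 < d * r)%N by rewrite muln_gt0 d0.
have leN : (N <= N * r)%N by rewrite leq_pmulr.
apply: eqmodq_trans (eqmodq_pp d0 leN) _; apply: eqmodq_sym.
apply: eqmodq_trans (eqmodqM (eqmodq_pp dr0 (leqnn N)) (eqmodq_ppV r d0 leN)) _.
suff -> : \prod_(i < N * r) (1 + qX ^+ (d * i.+1)) =
    (\prod_(i < N) (1 + qX ^+ (d * r * i.+1)))
    * \prod_(i < N * r) (if (r %| i.+1)%N then 1 else 1 + qX ^+ (d * i.+1)) by [].
elim: N {leN} => [|N IHN]; first by rewrite mul0n !big_ord0 mulr1.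
(* Each step adds a block of [r] factors, of which only the last has an index [i.+1] divisible by
   [r]. *)
rewrite mulSnr !big_split_ord IHN big_ord_recr /= -!mulrA; congr (_ * _).
rewrite [in RHS]mulrCA; congr (_ * _).
case: r r0 {dr0 IHN} => // r _; rewrite !big_ord_recr /=.
have -> : ((N * r.+1 + r).+1 = r.+1 * N.+1)%N by ring.
rewrite dvdn_mulr // mulr1 mulrC mulnA; congr (_ * _).
apply: eq_bigr => i _.
by rewrite -addnS dvdn_addr ?dvdn_mull // gtnNdvd // ltnS.
Qed.

Lemma pp_mul_qp r d : (0 < r)%N -> (0 < d)%N ->
  pp d * qp (d * r) (2 * (d * r)) = ppV r d.
Proof.
move=> r0 d0; have dr0 : (0 < d * r)%N by rewrite muln_gt0 d0.
by rewrite (pp_split r0 d0) mulrAC -[RHS]mul1r -(qp_pp dr0); ring.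
Qed.

Lemma ppV_ge0 r d : (0 < d)%N -> fps_ge0 (ppV r d).
Proof.
move=> d0; apply: fps_ge0_iprod (ppV_ok r d0) _ => i.
by case: ifP => _ n; rewrite ?fps_ge01 // addr_ge0 ?coef_fpsXn ?ler0n.
Qed.

Lemma qpV_ge0 m d : (0 < m)%N -> (0 < d)%N -> fps_ge0 (qp m d)^-1.
Proof.
move=> m0 d0 n; have Q := eqmodq_qp m0 d0 (leqnn n).
have U : \prod_(i < n) (1 - qX ^+ (m + d * i)) \is a GRing.unit.
  by apply: fps_unit1; rewrite -Q ?qp0.
rewrite (eqmodqV (qp_unit m0 d0) U Q) // -prodrV => [|i _]; last first.
  by apply: fps_unit1; rewrite coef_1BXn ?ltn_Dmul.
by apply: fps_ge0_prod => i _; apply: fps_ge0_geom; rewrite addn_gt0 m0.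
Qed.

(** Iterates [qp_split]; the leftover factor is 1 modulo q^(2^R). *)
Lemma qp_dyadic R :
  qp 1 1 = \prod_(r < R) qp (2 ^ r) (2 * 2 ^ r) * qp (2 ^ R) (2 ^ R).
Proof.
elim: R => [|R IHR]; first by rewrite big_ord0 mul1r expn0.
by rewrite IHR big_ord_recr /= -mulrA expnS -qp_split ?expn_gt0.
Qed.

(** In [shanks], the terms s >= 1 and the final q^(g_n) all have order at least n > N. *)
Lemma eqmodq_euler N n : (N < n)%N -> eqmodq N (qp 1 1) (ptrunc qX n).
Proof.
move=> lt_Nn; apply: eqmodq_trans (eqmodq_qp _ _ (ltnW lt_Nn)) _ => // m le_mN.
have E := shanks qX n; rewrite big_ord_recl /= in E.
move/(congr1 (fun f : fps => f m)): E.
have -> : \prod_(i < n) (1 - qX ^+ (1 + 1 * i)) = \prod_(0 <= i < n) (1 - qX ^+ i.+1).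
  by rewrite big_mkord; apply: eq_bigr => i _; rewrite mul1n.
have lt_mn : (m < n)%N by rewrite (leq_ltn_trans le_mN).
have coef_high (c : fps) a : (n <= a)%N -> (c * qX ^+ a) m = 0.
  by move=> le_na; rewrite mulrC coef_fpsXnM leqNgt (leq_trans lt_mn).
rewrite expr0 mul1r mul0n mulr1.
have coefD (f g : fps) : (f + g) m = f m + g m by [].
rewrite !coefD coef_high ?addr0; last exact: leq_gk.
rewrite (_ : (\sum_(i < n) _ : fps) m = 0) ?addr0 //.
elim/big_ind: _ => [//|f g f0 g0|i _]; first by rewrite coefD f0 g0 addr0.
by apply: coef_high; rewrite /bump /=; lia.
Qed.

(** * Positivity *)

(** Transfers the computations in [Z] to series. Values at negative arguments are lost, so shifts
    require them to vanish. *)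
Definition fps_ofZ (g : Z -> Z) : fps := Fps (fun n => int_of_Z (g (Z.of_nat n))).

Lemma fps_ofZXn a (g : Z -> Z) : (forall z, Z.lt z 0 -> g z = 0%coqZ) ->
  qX ^+ a * fps_ofZ g = fps_ofZ (fun z => g (z - Z.of_nat a)%coqZ).
Proof.
move=> g0; apply: fpsP => n; rewrite coef_fpsXnM /=.
case: leqP => [le_an|lt_na]; first by congr (int_of_Z (g _)); lia.
by rewrite g0 //; lia.
Qed.

Lemma fps_ofZB (g h : Z -> Z) :
  fps_ofZ g - fps_ofZ h = fps_ofZ (fun z => g z - h z)%coqZ.
Proof. by apply: fpsP => n /=; rewrite -[in RHS]/(_ - _)%R raddfB. Qed.

Lemma fps_ofZ_1BXn a (g : Z -> Z) : (forall z, Z.lt z 0 -> g z = 0%coqZ) ->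
  (1 - qX ^+ a) * fps_ofZ g = fps_ofZ (fun z => g z - g (z - Z.of_nat a))%coqZ.
Proof. by move=> g0; rewrite mulrBl mul1r fps_ofZXn // fps_ofZB. Qed.

Lemma eq_fps_ofZ (g h : Z -> Z) : (forall z, g z = h z) -> fps_ofZ g = fps_ofZ h.
Proof. by move=> gh; apply: fpsP => n /=; rewrite gh. Qed.

Lemma c135_fps :
  (1 - qX ^+ 5) * ((1 - qX ^+ 3) * ((1 - qX ^+ 1) * fps_ofZ c135)) = 30%:R.
Proof.
have cN := c135_neg.
rewrite !fps_ofZ_1BXn; try by move=> z z0; rewrite !cN //; lia.
rewrite (eq_fps_ofZ c135_rec) /=.
have E : fps_ofZ (fun z => if Z.eqb z 0 then 1 else 0)%coqZ = 1.
  by apply: fpsP => -[|n].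
rewrite -E; apply: fpsP => n.
have -> m : ((fps_ofZ (fun z => if Z.eqb z 0 then 1 else 0)%coqZ) *+ m) n
    = (fps_ofZ (fun z => if Z.eqb z 0 then 1 else 0)%coqZ) n *+ m.
  by elim: m => [|m IHm] //; rewrite !mulrS -IHm.
by case: n.
Qed.

Lemma tailc_fps f k :
  ptail qX f k * fps_ofZ c135 = fps_ofZ (tailc f (Z.of_nat k)).
Proof.
elim: f k => [|f IHf] k; first by apply: fpsP => n; rewrite mul0r.
rewrite [ptail _ _ _]/= !mulrBl mul1r -mulrA IHf !fps_ofZXn.
- rewrite !fps_ofZB; apply: fpsP => n; apply: (congr1 int_of_Z).
  rewrite [RHS]tailcS; last lia.
  cbn beta.
  by congr (_ - _ - tailc _ _ _)%coqZ; [congr c135| |]; lia.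
- by move=> z; apply: tailc_neg.
exact: c135_neg.
Qed.

Lemma int_of_Z_ge0 z : Z.le 0 z -> 0 <= int_of_Z z.
Proof. by case: z => // p []. Qed.

Lemma int_of_Z_gt0 z : Z.lt 0 z -> 0 < int_of_Z z.
Proof. by case: z => //= p _; rewrite ltz_nat; lia. Qed.

Definition den1357 : fps :=
  (1 - qX ^+ 1) * (1 - qX ^+ 3) * (1 - qX ^+ 5) * (1 - qX ^+ 7).

Lemma unit_1BXn m : (0 < m)%N -> 1 - qX ^+ m \is a GRing.unit.
Proof. by move=> m0; apply: fps_unit1; rewrite coef_1BXn. Qed.

Lemma den1357_unit : den1357 \is a GRing.unit.
Proof. by rewrite /den1357 !unitrM !unit_1BXn. Qed.

(** Let h and u be the quotients without and with the factor 1 - q^7. Then u_n = h_n + u_(n-7), so h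
    >= 0 gives u >= h, and u_n >= h_n + h_(n-7) > 0. *)
Lemma coef_ptail_den1357_gt0 f k n : (0 < k)%N -> (n < f)%N ->
  0 < (ptail qX f k / den1357) n.
Proof.
move=> k0 lt_nf.
pose den135 : fps := (1 - qX ^+ 1) * (1 - qX ^+ 3) * (1 - qX ^+ 5).
have U3 : den135 \is a GRing.unit by rewrite !unitrM !unit_1BXn.
have U7 := @unit_1BXn 7 isT.
pose h := ptail qX f k / den135.
have hE m : h m *+ 30 = int_of_Z (tailc f (Z.of_nat k) (Z.of_nat m)).
  rewrite -[RHS]/(fps_ofZ (tailc f (Z.of_nat k)) m) -tailc_fps.
  have -> : ptail qX f k * fps_ofZ c135 = h * 30%:R.
    rewrite -c135_fps -[in LHS](divrK U3 (ptail qX f k)) -/h /den135; ring.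
  rewrite mulr_natr; elim: 30%N => [|j IHj] //.
  by rewrite !mulrS IHj.
set u := _ / _.
have uE : u = h + qX ^+ 7 * u.
  have <- : u * (1 - qX ^+ 7) = h.
    by rewrite /u /den1357 -/den135 invrM // mulrA mulrAC -/h divrK.
  by ring.
have uE' m : u m = h m + if (7 <= m)%N then u (m - 7)%N else 0.
  by rewrite -coef_fpsXnM {1}uE.
have tailP m : (m < f)%N ->
    0 <= h m /\ (0 < h m + if (7 <= m)%N then h (m - 7)%N else 0).
  move=> lt_mf.
  have [H0 H1] := @tailc_ge0_gt0 f (Z.of_nat k) (Z.of_nat m) ltac:(lia) ltac:(lia).
  split; first by rewrite -(pmulrn_lge0 _ (isT : (0 < 30)%N)) hE int_of_Z_ge0.
  rewrite -(pmulrn_lgt0 _ (isT : (0 < 30)%N)) mulrnDl hE.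
  case: leqP => [lt7|le7].
    rewrite mul0rn addr0; apply: int_of_Z_gt0.
    by move: H1; rewrite [X in Z.add _ X]tailc_neg; lia.
  rewrite hE -raddfD; apply: int_of_Z_gt0.
  by rewrite (_ : Z.of_nat (m - 7) = Z.of_nat m - 7)%coqZ //; lia.
have u_ge m : (m < f)%N -> h m <= u m.
  elim/ltn_ind: m => m IHm lt_mf; rewrite uE' lerDl.
  case: leqP => // le7; have lt7 : (m - 7 < m)%N by lia.
  have lt7f := ltn_trans lt7 lt_mf.
  by apply: le_trans (IHm _ lt7 lt7f); case: (tailP _ lt7f).
rewrite uE'; have [_ H] := tailP n lt_nf; apply: lt_le_trans H _.
by rewrite lerD2l; case: leqP => // le7; apply: u_ge; lia.
Qed.

(** * The product side and the final assembly *)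

Definition dyadic_prod := fps_iprod (fun i =>
      let r := i.+1 in
      qpoch (qX ^+ (2 ^ r * r)%N) (qX ^+ (2 ^ r.+1 * r)%N)).

Lemma leq_2expM i : (i < 2 ^ i.+1 * i.+1)%N.
Proof. by rewrite leq_pmull // expn_gt0. Qed.

Lemma dyadic_prod_ok : prod_ok (fun i =>
      let r := i.+1 in
      qpoch (qX ^+ (2 ^ r * r)%N) (qX ^+ (2 ^ r.+1 * r)%N)).
Proof.
move=> i j le_ji.
rewrite -[LHS]/(qp (2 ^ i.+1 * i.+1) (2 ^ i.+2 * i.+1) j).
have lt_j : (j < 2 ^ i.+1 * i.+1)%N by apply: leq_ltn_trans le_ji (leq_2expM i).
have m0 := leq_ltn_trans (leq0n _) lt_j.
have d0 : (0 < 2 ^ i.+2 * i.+1)%N by rewrite muln_gt0 expn_gt0.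
rewrite (eqmodq_qp m0 d0 (leqnn j)) //.
have: eqmodq j (\prod_(i0 < j) (1 - qX ^+ (2 ^ i.+1 * i.+1 + 2 ^ i.+2 * i.+1 * i0))) 1.
  elim/big_ind: _ => [//|f g f1 g1|l _ m le_mj].
    by rewrite -[X in eqmodq _ _ X]mulr1; apply: eqmodqM.
  by rewrite coef_1BXn // (leq_ltn_trans le_mj) // (leq_trans lt_j) // leq_addr.
by apply.
Qed.

(** Modulo q^(N+1) the series is the product of 1 / (q^9; q^2)_oo and of the first N quotients
    [ppV], all with nonnegative coefficients. *)
Lemma dyadic_prod_ge0 : fps_ge0 (den1357 * (dyadic_prod / qp 1 1)).
Proof.
move=> N.
have U11 := @qp_unit 1 1 isT isT.
pose W := \prod_(i < N) ppV i.+1 (2 ^ i.+1).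
pose PN := \prod_(i < N) qp (2 ^ i.+1 * i.+1) (2 * (2 ^ i.+1 * i.+1)).
have WE : W = \prod_(i < N) pp (2 ^ i.+1) * PN.
  by rewrite -big_split; apply: eq_bigr => i _; rewrite -pp_mul_qp ?expn_gt0.
(* An exact identity at finite level; the leftover factor is 1 modulo q^(N+1) because N <
   2^(N+1). *)
have E : qp 1 1 * (pp 1 * W) = PN * qp (2 ^ N.+1) (2 ^ N.+1).
  have H : \prod_(i < N.+1) qp (2 ^ i) (2 * 2 ^ i) * \prod_(i < N.+1) pp (2 ^ i) = 1.
    by rewrite -big_split big1 // => i _; rewrite /= qp_pp // expn_gt0.
  have ppS : \prod_(i < N.+1) pp (2 ^ i) = pp 1 * \prod_(i < N) pp (2 ^ i.+1).
    by rewrite big_ord_recl.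
  rewrite WE [in LHS](qp_dyadic N.+1).
  transitivity (1 * (PN * qp (2 ^ N.+1) (2 ^ N.+1))); last exact: mul1r.
  by rewrite -[X in X * (PN * _)]H ppS; ring.
have EN : eqmodq N (dyadic_prod / qp 1 1) (pp 1 * W).
  rewrite -[pp 1 * W](mulKr U11) mulrC; apply: eqmodqM => //; rewrite E.
  apply: eqmodq_trans (eqmodq_iprod dyadic_prod_ok (leqnn N)) _.
  rewrite -[X in eqmodq _ X _]mulr1; apply: eqmodqM.
    rewrite (eq_bigr (fun i : 'I_N =>
      qp (2 ^ i.+1 * i.+1) (2 * (2 ^ i.+1 * i.+1)))) // => i _.
    by rewrite mulnA -expnS.
  have lt2N : (N < 2 ^ N.+1)%N.
    by rewrite (ltn_trans (ltn_expl N (isT : 1 < 2)%N)) // ltn_exp2l.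
  have N0 : (0 < 2 ^ N.+1)%N by rewrite expn_gt0.
  apply: eqmodq_sym; apply: eqmodq_trans (eqmodq_qp N0 N0 (leqnn N)) _.
  elim/big_ind: _ => [//|f g f1 g1|l _ m le_mj].
    by rewrite -[X in eqmodq _ _ X]mulr1; apply: eqmodqM.
  by rewrite coef_1BXn // (leq_ltn_trans le_mj) // (leq_trans lt2N) // leq_addr.
rewrite (eqmodqM (@eqmodq_refl N den1357) EN) // mulrA.
(* [pp 1] is 1 / (q; q^2)_oo, and [den1357] cancels its first four factors. *)
have -> : den1357 * pp 1 = (qp 9 2)^-1.
  have U9 : qp 9 2 \is a GRing.unit by apply: qp_unit.
  apply: (mulIr U9); rewrite mulVr // -[RHS](@qp_pp 1) //.
  rewrite muln1 (@qp_shift 1) // (@qp_shift 3) // (@qp_shift 5) //.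
  by rewrite (@qp_shift 7) // /den1357; ring.
apply: fps_ge0M; first by apply: qpV_ge0.
by apply: fps_ge0_prod => i _; apply: ppV_ge0; rewrite expn_gt0.
Qed.

Lemma dyadic_prod_coef0 : (den1357 * (dyadic_prod / qp 1 1)) 0%N = 1.
Proof.
have Q1 : (qp 1 1)^-1 0%N = 1.
  have := @coef0_fpsM (qp 1 1) (qp 1 1)^-1.
  by rewrite mulrV ?qp_unit // qp0 // mul1r => <-.
by rewrite /den1357 !coef0_fpsM Q1 (coef0_iprod dyadic_prod_ok) !coef_1BXn.
Qed.

Lemma CtildeE k :
  Ctilde k = (-1) ^+ k * (qp 1 1 - ptrunc qX k) * (dyadic_prod / qp 1 1).
Proof.
rewrite /Ctilde ptrunc_pent -/dyadic_prod -[qpoch qX qX]/(qp 1 1) div1r.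
have U11 := @qp_unit 1 1 isT isT.
by rewrite -[X in _ * (X - _)](mulVr U11); ring.
Qed.

(** Inserting [den1357] separates a factor whose relevant coefficients are positive from one that is
    nonnegative with constant term 1. Fuel [N.+1] is exact up to q^N, and the two signs (-1)^k
    cancel. *)
Lemma coef_Ctilde k N : Ctilde k N =
  if (gk k <= N)%N
  then (ptail qX N.+1 k / den1357
          * (den1357 * (dyadic_prod / qp 1 1))) (N - gk k)%N
  else 0.
Proof.
rewrite -coef_fpsXnM CtildeE.
have E : eqmodq N (qp 1 1 - ptrunc qX k) ((-1) ^+ k * qX ^+ gk k * ptail qX N.+1 k).
  rewrite -ptruncD => n le_nN.
  by rewrite -[LHS]/(_ n - _ n) (@eqmodq_euler N (k + N.+1)) //; lia.
rewrite (eqmodqM (eqmodqM (@eqmodq_refl N ((-1) ^+ k)) E) (@eqmodq_refl N _)) //.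
congr (coef_fps _ N).
rewrite [_ / den1357 * _]mulrA (divrK den1357_unit) !mulrA -expr2 sqrr_sign mul1r.
by [].
Qed.

Lemma coef_fpsM_gt0 (f g : fps) n : (forall i, (i <= n)%N -> 0 < f i) ->
  fps_ge0 g -> 0 < g 0%N -> 0 < (f * g) n.
Proof.
move=> f_gt0 g_ge0 g0; rewrite coef_fpsM big_ord_recr /= subnn.
apply: ltr_wpDl; last by apply: mulr_gt0 => //; apply: f_gt0.
apply: sumr_ge0 => i _; apply: mulr_ge0 => //.
by apply/ltW/f_gt0/ltnW.
Qed.

Theorem theorem3 (k : nat) (hk : (1 <= k)%N) :
  (forall n : nat, 0 <= Ctilde k n) /\
  (forall n : nat, 0 < Ctilde k n <-> (gk k <= n)%N).
Proof.
have pos n : (gk k <= n)%N -> 0 < Ctilde k n.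
  move=> le_gn; rewrite coef_Ctilde le_gn.
  apply: coef_fpsM_gt0 => [i le_in||].
  - by apply: coef_ptail_den1357_gt0 => //; rewrite ltnS (leq_trans le_in) ?leq_subr.
  - exact: dyadic_prod_ge0.
  by rewrite dyadic_prod_coef0.
have zero n : (n < gk k)%N -> Ctilde k n = 0.
  by move=> lt_ng; rewrite coef_Ctilde leqNgt lt_ng.
split=> n; first by case: (leqP (gk k) n) => [/pos /ltW //|/zero ->].
split=> [|/pos //]; case: leqP => // /zero ->; by rewrite ltxx.
Qed.
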